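(* For every integer $n\geq 1$, \[ D(n;q,t) = \sum_{k=0}^{n-1} (qt)^k\, D(k; q, 1/t)\, D(n-1-k; q, t),\] where $D(m;q,t)=\sum_{p\in \mathcal{D}(m)} q^{\operatorname{area}(p)}t^{\operatorname{rk}(p)}$ and $D(m;q,1/t)=\sum_{p\in \mathcal{D}(m)} q^{\operatorname{area}(p)}t^{-\operatorname{rk}(p)}$.
   Context: A Dyck path of order $m\ge 0$ is a lattice path from $(0,0)$ to $(2m,0)$ using $m$ up steps $(x,y)\to(x+1,y+1)$ and $m$ down steps $(x,y)\to(x+1,y-1)$ that never goes below the $x$-axis; $\mathcal{D}(m)$ is the set of them ($\mathcal{D}(0)$ consists of the empty path). The area $\operatorname{area}(p)$ of $p\in\mathcal{D}(m)$ is the number of points $(x,y)\in\mathbb{Z}^2$ with $x+y$ even and $y\ge 0$ that lie strictly below the path (i.e. below it and not on it). To $p\in \mathcal{D}(m)$ associate a set partition $\phi(p)$ of $\{1,\dots,m\}$: $i$ and $i'$ lie in the same block iff there is $j$ such that both points $(2i-1,2j-1)$ and $(2i'-1,2j-1)$ lie on $p$ and the portion of $p$ between them never goes below the line $y=2j-1$. (This is a bijection from $\mathcal{D}(m)$ onto noncrossing partitions of $\{1,\dots,m\}$.) The rank of $p$ is $\operatorname{rk}(p)=m-(\text{number of blocks of }\phi(p))$, i.e. its rank in the noncrossing partition lattice ordered by reverse refinement. In particular $D(0;q,t)=1$. *)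

(* Defs.v *)
From HB Require Import structures.
From mathcomp Require Import all_boot all_order all_algebra.
Set Implicit Arguments.
Unset Strict Implicit.
Unset Printing Implicit Defensive.
Import Order.TTheory GRing.Theory Num.Theory.
Local Open Scope ring_scope.

(* A lattice path from (0,0) is the sequence of its steps: [true] is the up  *)
(* step (1,1), [false] the down step (1,-1).  [height s x] is the ordinate   *)
(* of the path at abscissa x, meaningful for x <= size s.                    *)
Definition height (s : seq bool) (x : nat) : int :=
  (count_mem true (take x s))%:Z - (count_mem false (take x s))%:Z.

Definition is_dyck (m : nat) (p : (m.*2).-tuple bool) : bool :=
  [&& count_mem true p == m, count_mem false p == m
    & [forall x : 'I_(m.*2).+1, 0 <= height p x]].

Definition dyck (m : nat) : {set (m.*2).-tuple bool} :=
  [set p | is_dyck p].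

(* The coordinates may be bounded by 2m, since 0 <= x <= 2m under the path   *)
(* and height p x <= x.                                                      *)
Definition area (m : nat) (p : (m.*2).-tuple bool) : nat :=
  #|[set xy : 'I_(m.*2).+1 * 'I_(m.*2).+1 |
      ~~ odd (xy.1 + xy.2)%N && ((xy.2 : nat)%:Z < height p xy.1)]|.

(* The ordinal i : 'I_m stands for the element i + 1 of {1, ..., m}, hence   *)
(* for the abscissa 2(i + 1) - 1 = 2i + 1; likewise j : 'I_m stands for the  *)
(* level 2(j + 1) - 1 = 2j + 1.  On a Dyck path of order m the heights lie   *)
(* between 0 and m, so that no other level is possible.                      *)
Definition same_block (m : nat) (p : (m.*2).-tuple bool) : rel 'I_m :=
  fun i i' =>
    [exists j : 'I_m,
      [&& height p i.*2.+1 == (j.*2.+1)%:Z,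
          height p i'.*2.+1 == (j.*2.+1)%:Z
        & [forall x : 'I_(m.*2).+1,
            (minn i.*2.+1 i'.*2.+1 <= x <= maxn i.*2.+1 i'.*2.+1)%N ==>
            ((j.*2.+1)%:Z <= height p x)]]].

Definition phi (m : nat) (p : (m.*2).-tuple bool) : {set {set 'I_m}} :=
  equivalence_partition (same_block p) [set: 'I_m].

Definition rk (m : nat) (p : (m.*2).-tuple bool) : nat := (m - #|phi p|)%N.

Definition dyck_gf (R : comNzRingType) (m : nat) (q t : R) : R :=
  \sum_(p in dyck m) q ^+ area p * t ^+ rk p.

(* Main.v *)
Require Import Defs.
From HB Require Import structures.
From mathcomp Require Import all_boot all_order all_algebra.
From mathcomp Require Import zify.
Import Order.TTheory GRing.Theory Num.Theory.
Local Open Scope ring_scope.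

(** The leftmost elements of the blocks of [phi p] are the odd abscissas that
    the path reaches by an up step, so the number of blocks is the number of
    up steps at even positions, counting from 0.  Cut [p] at its first return
    to the axis, [p = U a D b] with [a] of order [k].  Lifting [a] adds one
    point below each of its [k] points of odd abscissa, so the area is
    [k + area a + area b].  Shifting [a] by one step exchanges even and odd
    positions, so [a] contributes its [rk a] up steps at odd
    positions instead, and [rk p = k - rk a + rk b]. *)

(** * Heights along a lattice path *)

Lemma height0 s : height s 0 = 0.
Proof. by rewrite /height take0. Qed.

Lemma height_cons b s x :
  height (b :: s) x.+1 = (if b then 1 else -1) + height s x.
Proof. by rewrite /height /=; case: b => /=; lia. Qed.

Lemma height_cat s1 s2 x :
  height (s1 ++ s2) x =
  if (x < size s1)%N then height s1 x
  else height s1 (size s1) + height s2 (x - size s1)%N.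
Proof.
rewrite /height take_cat take_size; case: ifP => // _.
by rewrite !count_cat; lia.
Qed.

Lemma height_oversize s x : (size s <= x)%N -> height s x = height s (size s).
Proof. by move=> lesx; rewrite /height take_oversize // take_size. Qed.

Lemma height_succ s x : (x < size s)%N ->
  height s x.+1 = height s x + (if nth false s x then 1 else -1).
Proof.
move=> ltxs; rewrite /height (take_nth false ltxs) -cats1 !count_cat /=.
by case: (nth false s x) => /=; lia.
Qed.

Lemma odd_height s x : (x <= size s)%N -> odd `|height s x|%N = odd x.
Proof.
elim: x => [|x IH] lexs; first by rewrite height0.
have := IH (ltnW lexs); rewrite height_succ //=.
by case: (nth false s x); lia.
Qed.

Lemma height_le s x : height s x <= x%:Z.
Proof.
have lesx : (size (take x s) <= x)%N by rewrite size_take_min geq_minl.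
have := leq_trans (count_size (pred1 true) _) lesx.
by rewrite /height; lia.
Qed.

(** [x] can range over all naturals: past the end, [height] keeps its final value. *)
Definition nonneg_path (s : seq bool) : Prop := forall x, 0 <= height s x.

Lemma is_dyckP m (p : (m.*2).-tuple bool) :
  reflect (nonneg_path p /\ height p m.*2 = 0) (is_dyck p).
Proof.
have cntE : (count_mem true p + count_mem false p = m.*2)%N.
  rewrite -[RHS](size_tuple p) -(count_predC (pred1 true)).
  by congr (_ + _)%N; apply: eq_count => -[].
have endE : height p m.*2 = (count_mem true p)%:Z - (count_mem false p)%:Z.
  by rewrite /height take_oversize ?size_tuple.
apply: (iffP and3P) => [[/eqP ct /eqP cf /forallP pos]|[pos end0]].
  split; last by rewrite endE; lia.
  move=> x; have [lexm|ltmx] := leqP x m.*2.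
    by have := pos (Ordinal (n := m.*2.+1) (m := x) lexm).
  have -> : height p x = height p m.*2.
    by rewrite height_oversize ?size_tuple //; apply: ltnW.
  by rewrite endE; lia.
by split; [lia | lia | apply/forallP => x; apply: pos].
Qed.

(** * The area as a sum over columns *)

Definition path_area (s : seq bool) : nat :=
  (\sum_(0 <= x < (size s).+1) `|height s x|./2)%N.

(** The values counted are [h - 2], [h - 4], and so on down to 0 or 1. *)
Lemma sum_same_parity h :
  (\sum_(0 <= y < h | ~~ odd (h + y)) 1)%N = h./2.
Proof.
(* Removing the two top values of [y] lowers [h] by 2, so the induction carries two consecutive
   cases. *)
suff: (\sum_(0 <= y < h | ~~ odd (h + y)) 1 = h./2)%N /\
      (\sum_(0 <= y < h.+1 | ~~ odd (h.+1 + y)) 1 = (h.+1)./2)%N by case.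
elim: h => [|h [IH1 IH2]].
  by rewrite big_geq // big_mkcond big_nat1.
split=> //; rewrite big_mkcond !big_nat_recr //= -big_mkcond /=.
under eq_bigl do rewrite negbK.
have -> : ~~ ~~ ~~ odd (h + h) by lia.
have -> : ~~ ~~ ~~ odd (h + h.+1) = false by lia.
by rewrite addn0 IH1; lia.
Qed.

Lemma areaE m (p : (m.*2).-tuple bool) : is_dyck p -> area p = path_area p.
Proof.
move=> /is_dyckP [pos _].
rewrite /area -sum1_card /path_area size_tuple big_mkord.
under eq_bigl do rewrite inE.
rewrite -(pair_big_dep xpredT
  (fun x y : 'I_(m.*2).+1 => ~~ odd (x + y) && (y%:Z < height p x))
  (fun _ _ => 1%N)) /=.
apply: eq_bigr => x _; rewrite -sum_same_parity.
have lexm : (x <= m.*2)%N by rewrite -ltnS.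
have odx : odd `|height p x| = odd x by rewrite odd_height // size_tuple.
have := height_le p x; have := pos x => h0 hx.
(* The bound on ordinates in [area] loses no point, since the height at [x] is at most [x]. *)
have lehm : (`|height p x| <= m.*2.+1)%N by lia.
rewrite (big_nat_widen _ _ _ _ _ lehm) big_mkord.
by apply: eq_bigl => y; rewrite !oddD odx; lia.
Qed.

(** * Blocks and their leftmost elements *)

Section Blocks.
Variables (m : nat) (p : (m.*2).-tuple bool).
Hypothesis dyck_p : is_dyck p.

(** The level [j] can be eliminated: heights at odd abscissas are odd, so [j] is half the height at
    [i], rounded down. *)
Lemma same_blockP (i i' : 'I_m) :
  reflect (height p i.*2.+1 = height p i'.*2.+1 /\
           forall x, (minn i.*2.+1 i'.*2.+1 <= x <= maxn i.*2.+1 i'.*2.+1)%N ->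
             height p i.*2.+1 <= height p x)
          (same_block p i i').
Proof.
have [pos _] := is_dyckP _ _ dyck_p.
apply: (iffP existsP) => [[j /and3P [/eqP hi /eqP hi' /forallP above]]|[eqh above]].
  split=> [|x xb]; first by rewrite hi hi'.
  have ltx : (x < m.*2.+1)%N by have := ltn_ord i; have := ltn_ord i'; lia.
  by have /implyP := above (Ordinal ltx); rewrite hi; apply.
have lti := ltn_ord i.
have odi : odd `|height p i.*2.+1| by rewrite odd_height ?size_tuple; lia.
have := pos i.*2.+1; have := height_le p i.*2.+1 => hle hge.
have ltj : (`|height p i.*2.+1|./2 < m)%N by lia.
exists (Ordinal ltj); rewrite /= -eqh.
have -> : (`|height p i.*2.+1|./2.*2.+1)%:Z = height p i.*2.+1 by lia.
rewrite eqxx /=; apply/forallP => x; apply/implyP; exact: above.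
Qed.

Lemma same_block_refl i : same_block p i i.
Proof.
apply/same_blockP; split=> // x xb.
by have -> : x = i.*2.+1 by lia.
Qed.

Lemma same_block_sym i i' : same_block p i i' -> same_block p i' i.
Proof.
move=> /same_blockP [eqh above]; apply/same_blockP; split=> // x xb.
by rewrite -eqh; apply: above; lia.
Qed.

Lemma same_block_trans i1 i2 i3 :
  same_block p i1 i2 -> same_block p i2 i3 -> same_block p i1 i3.
Proof.
move=> /same_blockP [e12 above12] /same_blockP [e23 above23].
apply/same_blockP; split=> [|x xb]; first by rewrite e12.
(* In whatever order the three indices come, an abscissa between [i1] and [i3] lies between [i1] and
   [i2] or between [i2] and [i3]. *)
have [xb12|xb12] := boolP (minn i1.*2.+1 i2.*2.+1 <= x <= maxn i1.*2.+1 i2.*2.+1)%N.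
  exact: above12.
by rewrite e12; apply: above23; lia.
Qed.

                                                                               
                                                                               
(** If [i] is reached by a down step, take the last earlier abscissa [y] strictly below the level of
    [i]. The path leaves [y] by an up step to that level and stays at or above it until [i]; by
    parity [y] is even, and [y./2] is the index sought. *)
Lemma same_block_leftmost i :
  exists2 a : 'I_m, nth false p a.*2 & same_block p a i.
Proof.
have [pos _] := is_dyckP _ _ dyck_p.
have [n lein] := ubnP (i : nat); elim: n i lein => // n IH i lein.
have [up|down] := boolP (nth false p i.*2).
  by exists i => //; apply: same_block_refl.
have lti := ltn_ord i.
have succi : height p i.*2.+1 = height p i.*2 - 1.
  by rewrite height_succ ?size_tuple; [rewrite (negbTE down) | lia].
have odi : odd `|height p i.*2.+1| by rewrite odd_height ?size_tuple; lia.
have posi := pos i.*2.+1.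
pose P y := (y <= i.*2)%N && (height p y < height p i.*2.+1).
have exP : exists y, P y by exists 0%N; rewrite /P height0; lia.
have leP y : P y -> (y <= i.*2)%N by case/andP.
case: (ex_maxnP exP leP) => y /andP [ley lty] maxy.
have ney : y != i.*2 by apply/eqP => yE; move: lty; rewrite yE succi; lia.
have above x : (y < x <= i.*2.+1)%N -> height p i.*2.+1 <= height p x.
  move=> xb; have [->//|nex] := eqVneq x i.*2.+1.
  rewrite leNgt; apply/negP => ltx.
  by have := maxy x; rewrite /P ltx; lia.
have lty2 : (y < size p)%N by rewrite size_tuple; lia.
have hyS := height_succ p _ lty2; have := above y.+1.
have odyS : odd `|height p y.+1| = odd y.+1 by rewrite odd_height.
case E: (nth false p y) hyS => hyS aby; last by lia.
have ye : (y = y./2.*2)%N by lia.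
have lta : (y./2 < m)%N by lia.
exists (Ordinal lta); rewrite /= -?ye //.
apply/same_blockP; rewrite /= -ye; split=> [|x xb]; first by lia.
by have := above x; lia.
Qed.

(** If [a < b], the up step into [b] starts one below the common level, at an abscissa between the
    two points. *)
Lemma leftmost_inj (a b : 'I_m) : nth false p a.*2 -> nth false p b.*2 ->
  same_block p a b -> a = b.
Proof.
wlog leab : a b / (a <= b)%N.
  move=> H; case/orP: (leq_total a b) => leab ua ub sab; first exact: H.
  by apply/esym/H => //; apply: same_block_sym.
move=> ua ub /same_blockP [eqh above]; apply/val_inj => /=.
have lb := ltn_ord b.
have := height_succ p b.*2; rewrite size_tuple ub.
by have := above b.*2; lia.
Qed.

Lemma card_phi : #|phi p| = (\sum_(i < m) nth false p i.*2)%N.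
Proof.
pose cl (i : 'I_m) := [set y in [set: 'I_m] | same_block p i y].
have clE i i' : same_block p i i' -> cl i = cl i'.
  move=> sii'; apply/setP => y; rewrite !inE /=.
  by apply/idP/idP; apply: same_block_trans => //; apply: same_block_sym.
have -> : phi p = cl @: [set a : 'I_m | nth false p a.*2].
  apply/setP => B; apply/imsetP/imsetP => -[i _ ->]; last by exists i.
  have [a ua sai] := same_block_leftmost i.
  by exists a; rewrite ?inE // -/(cl i) (clE _ _ sai).
rewrite card_in_imset.
  by rewrite -sum1_card big_mkcond /=; apply: eq_bigr => i _; rewrite inE; case: nth.
move=> a b; rewrite !inE => ua ub /setP /(_ b).
by rewrite !inE /= same_block_refl; apply: leftmost_inj.
Qed.

End Blocks.

                                                                               
                                                                               
(** * Up steps by parity of position *)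

(** The flag [b] says whether the current position counts: [true] selects the even positions,
    [false] the odd ones. Shifting a path by one step negates the flag. *)
Fixpoint ups_at (b : bool) (s : seq bool) : nat :=
  if s is a :: s' then ((a && b) + ups_at (~~ b) s')%N else 0%N.

Lemma ups_at_cat b s1 s2 :
  ups_at b (s1 ++ s2) = (ups_at b s1 + ups_at (b (+) odd (size s1)) s2)%N.
Proof.
elim: s1 b => [|a s1 IH] b /=; first by rewrite addbF.
by rewrite IH addnA; congr (_ + ups_at _ _)%N; case: b; case: odd.
Qed.

Lemma ups_at_compl b s : (ups_at b s + ups_at (~~ b) s = count_mem true s)%N.
Proof.
elim: s b => //= a s IH b; rewrite -(IH b) negbK.
by case: a; case: b => /=; lia.
Qed.

Lemma ups_at_evenE m s : size s = m.*2 ->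
  ups_at true s = (\sum_(i < m) nth false s i.*2)%N.
Proof.
elim: m s => [|m IH] [|a [|b s]] //=; first by rewrite big_ord0.
move=> [sz]; rewrite big_ord_recl /= andbT andbF add0n (IH s sz).
by congr (_ + _)%N; apply: eq_bigr.
Qed.

Lemma rkE m (p : (m.*2).-tuple bool) : is_dyck p ->
  rk p = (m - ups_at true p)%N.
Proof. by move=> dp; rewrite /rk card_phi // (ups_at_evenE m) // size_tuple. Qed.

Lemma ups_at_dyck m (p : (m.*2).-tuple bool) : is_dyck p ->
  (ups_at true p + ups_at false p = m)%N.
Proof. by case/and3P=> /eqP cm _ _; rewrite (ups_at_compl true). Qed.

(** * Lifting a path and cutting at a return to the axis *)

Definition arch (a b : seq bool) : seq bool := true :: a ++ false :: b.

Lemma height_arch_in a b x : (x <= size a)%N ->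
  height (arch a b) x.+1 = 1 + height a x.
Proof.
rewrite height_cons height_cat leq_eqVlt => /orP [/eqP ->|-> //].
by rewrite ltnn subnn height0 addr0.
Qed.

Lemma height_arch_out a b x : height a (size a) = 0 ->
  height (arch a b) ((size a).+2 + x) = height b x.
Proof.
move=> ha; rewrite addSn height_cons height_cat.
have -> : ((size a).+1 + x < size a)%N = false by lia.
have -> : ((size a).+1 + x - size a)%N = x.+1 by lia.
by rewrite height_cons ha; lia.
Qed.

Lemma sum_odd k : (\sum_(0 <= x < k.*2.+1) odd x = k)%N.
Proof.
elim: k => [|k IH]; first by rewrite big_nat1.
by rewrite doubleS !big_nat_recr //= in IH *; lia.
Qed.

(** In the lifted part, [(1 + h)./2 = h./2 + odd h], and [h] has the parity of its abscissa; the odd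
    abscissas of [a] thus supply the summand [k]. *)
Lemma path_area_arch k a b : size a = k.*2 -> nonneg_path a ->
  height a (size a) = 0 ->
  path_area (arch a b) = (k + path_area a + path_area b)%N.
Proof.
move=> sza pos ha; rewrite /path_area /arch /= size_cat /=.
rewrite (@big_cat_nat _ _ _ (size a).+2) //=; last by lia.
congr (_ + _)%N; last first.
  rewrite -{1}[(size a).+2]add0n big_addn.
  have -> : ((size a + (size b).+1).+2 - (size a).+2 = (size b).+1)%N by lia.
  by apply: eq_bigr => x _; rewrite addnC -/(arch a b) height_arch_out.
rewrite big_nat_recl //= add0n -{1}(sum_odd k) sza -big_split /=.
apply: eq_big_nat => x /andP [_ ltx].
rewrite -/(arch a b) height_arch_in ?sza //.
have odx : odd `|height a x| = odd x by rewrite odd_height // sza.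
by have := pos x; lia.
Qed.

Lemma nonneg_arch a b : nonneg_path a -> height a (size a) = 0 ->
  nonneg_path b -> nonneg_path (arch a b).
Proof.
move=> pa ha pb x; have [ltx|lex] := ltnP x (size a).+2; last first.
  by rewrite -(subnKC lex) height_arch_out.
case: x ltx => [|x] ltx; first by rewrite height0.
by rewrite height_arch_in //; have := pa x; lia.
Qed.

(** Nonnegativity forces the first step to go up and the step arriving at height 0 to go down. *)
Lemma arch_decomp k s : (k.*2.+2 <= size s)%N -> nonneg_path s ->
  height s k.*2.+2 = 0 ->
  s = arch (take k.*2 (behead s)) (drop k.*2.+2 s).
Proof.
move=> ltk pos h0; have ltk1 : (k.*2.+1 < size s)%N by [].
have := height_succ s _ ltk1; have := pos k.*2.+1; rewrite h0.
case E: (nth false s k.*2.+1) => hk hE; first by lia.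
case: s ltk pos h0 ltk1 E {hk hE} => // c s ltk pos h0 ltk1 /= E.
have := pos 1%N; rewrite height_cons height0; case: c ltk ltk1 {pos h0} => // ltk ltk1 _.
by rewrite /arch -{1}(cat_take_drop k.*2 s) (drop_nth false) // E.
Qed.

(** * The first return to the axis *)

Definition to_tuple (m : nat) (s : seq bool) : m.-tuple bool :=
  insubd [tuple of nseq m false] s.

Lemma val_to_tuple m s : size s = m -> to_tuple m s = s :> seq bool.
Proof. by move=> sz; rewrite val_insubd sz eqxx. Qed.

(** Returns occur only at even abscissas, so [k] encodes the abscissa [2k + 2]. The default
    [ord_max] stands for the endpoint, which is a return of every Dyck path of order [n + 1]. *)
Definition first_return (n : nat) (s : seq bool) : 'I_n.+1 :=
  [arg min_(k < ord_max | height s k.*2.+2 == 0) (k : nat)]%N.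

Lemma first_returnP n (p : (n.+1.*2).-tuple bool) (k : 'I_n.+1) : is_dyck p ->
  reflect (height p k.*2.+2 = 0 /\
           forall y, (0 < y < k.*2.+2)%N -> 0 < height p y)
          (first_return n p == k).
Proof.
move=> /is_dyckP [pos end0]; rewrite /first_return.
case: arg_minnP => [|r /eqP hr minr]; first by apply/eqP.
apply: (iffP eqP) => [<-|[hk posk]].
  split=> // y yb; rewrite lt_neqAle pos andbT; apply/negP => /eqP hy.
  have ltr := ltn_ord r.
  (* A zero at [y > 0] has [y] even, hence is the return of index [y.-1./2], against the minimality
     of [r]. *)
  have ody : odd `|height p y| = odd y by rewrite odd_height // size_tuple; lia.
  have lty : (y.-1./2 < n.+1)%N by lia.
  have ye : y = (y.-1./2).*2.+2 by lia.
  have := minr (Ordinal lty); rewrite /= -ye -hy => /(_ isT); lia.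
apply/val_inj/eqP; rewrite eqn_leq minr ?hk //= leqNgt; apply/negP => ltrk.
by have := posk r.*2.+2; rewrite hr; lia.
Qed.

(** * The bijection between paths with given first return and pairs of paths *)

Section Join.
Variables (n : nat) (k : 'I_n.+1).
(** Left unsimplified to agree with the index [n - 1 - k] of the recursion at [n.+1]. *)
Let l := (n.+1 - 1 - k)%N.

Definition join (ab : (k.*2).-tuple bool * (l.*2).-tuple bool) :
  (n.+1.*2).-tuple bool := to_tuple (n.+1.*2) (arch ab.1 ab.2).

Definition unjoin (p : (n.+1.*2).-tuple bool) :
  (k.*2).-tuple bool * (l.*2).-tuple bool :=
  (to_tuple k.*2 (take k.*2 (behead p)), to_tuple l.*2 (drop k.*2.+2 p)).

Lemma val_join ab : join ab = arch ab.1 ab.2 :> seq bool.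
Proof.
rewrite val_to_tuple //= size_cat /= !size_tuple.
by have := ltn_ord k; rewrite /l; lia.
Qed.

Lemma val_unjoin1 p : (unjoin p).1 = take k.*2 (behead p) :> seq bool.
Proof.
rewrite val_to_tuple // size_takel // size_behead size_tuple.
by have := ltn_ord k; lia.
Qed.

Lemma val_unjoin2 p : (unjoin p).2 = drop k.*2.+2 p :> seq bool.
Proof.
by rewrite val_to_tuple // size_drop size_tuple /l; have := ltn_ord k; lia.
Qed.

Lemma joinK : cancel join unjoin.
Proof.
move=> [a b]; rewrite [unjoin _]surjective_pairing; congr pair; apply: val_inj.
  apply: (etrans (val_unjoin1 _)); rewrite val_join /=.
  by rewrite take_size_cat ?size_tuple.
apply: (etrans (val_unjoin2 _)); rewrite val_join /=.
by rewrite drop_cat size_tuple ltnNge leqnSn /= subSnn /= drop0.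
Qed.

Lemma unjoinK p : is_dyck p -> first_return n p = k -> join (unjoin p) = p.
Proof.
move=> dp /eqP /first_returnP => /(_ dp) [hk _]; have [pos _] := is_dyckP _ _ dp.
apply: val_inj; rewrite /= val_join val_unjoin1 val_unjoin2 -arch_decomp //.
by rewrite size_tuple; have := ltn_ord k; lia.
Qed.

(** As an equality of booleans over all pairs of tuples, this rewrites the range of the reindexed
    sum. *)
Lemma dyck_join ab :
  is_dyck (join ab) && (first_return n (join ab) == k) =
  is_dyck ab.1 && is_dyck ab.2.
Proof.
have ltk := ltn_ord k.
case: ab => a b /=; have joinE := val_join (a, b); rewrite /= in joinE.
have sa := size_tuple a; have sb := size_tuple b.
have endE : (n.+1.*2 = (size a).+2 + l.*2)%N by rewrite sa /l; lia.
apply/andP/andP => [[dj /first_returnP]|[/is_dyckP [pa ha] /is_dyckP [pb hb]]].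
  move=> /(_ dj) [hk posk]; have [pos end0] := is_dyckP _ _ dj.
  rewrite joinE in hk posk pos end0.
  (* Before the first return the heights are at least 1, so undoing the lift keeps them
     nonnegative. *)
  have ha x : (x <= k.*2)%N -> height a x = height (arch a b) x.+1 - 1.
    by move=> lex; rewrite height_arch_in ?sa //; lia.
  have pa x : 0 <= height a x.
    have [lex|ltx] := leqP x k.*2; first by rewrite ha //; have := posk x.+1; lia.
    rewrite height_oversize sa; last exact: ltnW.
    by rewrite ha //; have := posk k.*2.+1; lia.
  (* One step before the return the height is at least 1 and differs by 1 from 0, so it is exactly
     1. *)
  have ha0 : height a (size a) = 0.
    have := pa (size a); have := @height_succ (arch a b) k.*2.+1.
    rewrite sa /= size_cat /= sa sb hk ha // => hE; have {hE} := hE _.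
    by case: ifP => _ ; lia.
  split; apply/is_dyckP; split=> //; first by rewrite sa in ha0.
    by move=> x; have := pos ((size a).+2 + x)%N; rewrite height_arch_out.
  by rewrite -(height_arch_out a) // -endE.
have {}ha : height a (size a) = 0 by rewrite sa.
have dj : is_dyck (join (a, b)).
  apply/is_dyckP; rewrite joinE endE height_arch_out //; split=> //.
  exact: nonneg_arch.
split=> //; apply/first_returnP => //; rewrite joinE; split.
  by have := height_arch_out a b 0 ha; rewrite sa addn0 height0.
case=> // y yb; rewrite height_arch_in ?sa; last by lia.
by have := pa y; lia.
Qed.

Lemma area_join a b : is_dyck a -> is_dyck b ->
  area (join (a, b)) = (k + area a + area b)%N.
Proof.
move=> da db; have : is_dyck a && is_dyck b by rewrite da.
rewrite -(dyck_join (a, b)) => /andP [dj _].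
have [pa ha] := is_dyckP _ _ da.
by rewrite !areaE // val_join (path_area_arch k) ?size_tuple.
Qed.

                                                                               
                                                                               
(** The first step accounts for one block, [a] starts at the odd position 1 and [b] at the even
    position [2k + 2]. The up steps of [a] at odd positions number [rk a]. *)
Lemma rk_join a b : is_dyck a -> is_dyck b ->
  rk (join (a, b)) = (k - rk a + rk b)%N.
Proof.
move=> da db; have : is_dyck a && is_dyck b by rewrite da.
rewrite -(dyck_join (a, b)) => /andP [dj _].
have ltk := ltn_ord k.
rewrite !rkE // val_join /arch /= ups_at_cat size_tuple odd_double /=.
by have := ups_at_dyck _ _ da; have := ups_at_dyck _ _ db; rewrite /l; lia.
Qed.

End Join.

Theorem mainTheorem1 (R : comUnitRingType) (q t : R)
    (ht : t \is a GRing.unit) (n : nat) (hn : (1 <= n)%N) :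
  dyck_gf n q t =
    \sum_(k < n) (q * t) ^+ k * dyck_gf k q t^-1 * dyck_gf (n - 1 - k) q t.
Proof.
case: n hn => // n _.
rewrite {1}/dyck_gf 
  (partition_big (fun p : (n.+1.*2).-tuple bool => first_return n p) xpredT) //=.
apply: eq_bigr => k _.
rewrite (reindex_onto (join n k) (unjoin n k)) /=; last first.
  by move=> p /andP []; rewrite inE => dp /eqP; apply: unjoinK.
under eq_bigl => ab do rewrite inE dyck_join joinK eqxx andbT.
rewrite -(pair_big (fun a => is_dyck a) (fun b => is_dyck b)
  (fun a b => q ^+ area (join n k (a, b)) * t ^+ rk (join n k (a, b)))) /=.
rewrite -mulrA /dyck_gf big_distrl big_distrr /=.
apply: eq_big => [a|a da]; first by rewrite inE.
rewrite !big_distrr /=.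
apply: eq_big => [b|b db]; first by rewrite inE.
(* The subtraction [k - rk a] is not truncated, so with [t] a unit it splits as [t ^+ k] times a
   power of [t^-1]. *)
have lera : (rk a <= k)%N by rewrite leq_subr.
rewrite area_join // rk_join // !exprD exprMn exprVn exprB //.
by rewrite mulrACA (mulrACA (q ^+ k)) -!mulrA.
Qed.
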